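(* For $n\ge 1$, let $f_0(n)$ be the number of binary words (over $\{0,1\}$) of length $n-1$ in which $0$ appears only in runs of even length, and $1$ appears only in runs whose length is divisible by $3$. For $1\le k\le n$ let $$c_1(n,k)=\sum_{i_1+i_2+\cdots+i_k=n}f_0(i_1)f_0(i_2)\cdots f_0(i_k),$$ the sum being over positive integers $i_1,\ldots,i_k$. Then, for $1\le k\le n$, $$c_1(n,k)=\sum_{i=0}^k\sum_{j=i}^{n-k}\binom{k}{i}\binom{j-1}{i-1}\binom{j}{n-k-2j}.$$
   Context: A run is a maximal block of consecutive equal letters. Equivalently, $f_0(1)=1$, $f_0(2)=0$, $f_0(3)=1$, $f_0(n+3)=f_0(n+1)+f_0(n)$ for $n\ge1$. Conventions for binomial coefficients: $\binom{-1}{-1}=1$; $\binom{r}{s}=0$ if $r\ge 0$ and ($s<0$ or $s>r$). Sums whose upper limit is smaller than the lower limit are $0$. *)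

(* Defs.v *)
From mathcomp Require Import all_boot all_order all_algebra.

Set Implicit Arguments.
Unset Strict Implicit.
Unset Printing Implicit Defensive.

(* Binary words are sequences of booleans, with false for 0 and true for 1.
   A block is a nonempty interval of positions s, ..., t - 1, all carrying b. *)
Definition is_block (w : seq bool) (b : bool) (s t : nat) : bool :=
  (s < t <= size w) && all (pred1 b) (drop s (take t w)).

(* A run is a block that no other block contains; its length is t - s. *)
Definition is_run (w : seq bool) (b : bool) (s t : nat) : bool :=
  is_block w b s t &&
  [forall s' : 'I_(size w).+1, forall t' : 'I_(size w).+1,
     [&& is_block w b s' t', s' <= s & t <= t'] ==> (s' == s :> nat) && (t' == t :> nat)].

Definition admissible (w : seq bool) : bool :=
  [forall s : 'I_(size w).+1, forall t : 'I_(size w).+1,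
     (is_run w false s t ==> (2 %| t - s)) && (is_run w true s t ==> (3 %| t - s))].

(* Meaningful for n >= 1 only. *)
Definition f0 (n : nat) : nat := #|[set w : n.-1.-tuple bool | admissible w]|.

(* Positive parts with sum n are at most n, so 'I_n.+1 loses no composition. *)
Definition c1 (n k : nat) : nat :=
  \sum_(t : {ffun 'I_k -> 'I_n.+1} | [forall a, 0 < t a] && (\sum_a t a == n))
    \prod_a f0 (t a).

(* The usual coefficient for r, s >= 0, zero for s < 0 <= r, and 1 at (-1, -1);
   the value 0 at the remaining arguments with r < 0 is arbitrary. *)
Definition binz (r s : int) : nat :=
  match r, s with
  | Posz m, Posz p => 'C(m, p)
  | _, _ => if (r == -1)%R && (s == -1)%R then 1 else 0
  end.

(* Main.v *)
Require Import Defs.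
From mathcomp Require Import all_boot all_order all_algebra.
From mathcomp Require Import zify ring.
Import GRing.Theory.

(** A word is admissible exactly when it is a concatenation of blocks 00 and
    111, and such a factorization is unique, being forced from left to right by
    the first letter. Hence the number [W m] of admissible words of length [m]
    satisfies [W m = [m = 0] + W (m - 2) + W (m - 3)], that is, with
    [Y = X^2 + X^3], the generating function of [W] is [1 / (1 - Y)]
    ([nb_admissible_rec], [admissible_poly_inverse]).

    Since [f0 n = W (n - 1)], the number [c1 n k] is the coefficient of [X^n] in
    [X^k / (1 - Y)^k] ([c1_coef]). The negative binomial series expands
    [1 / (1 - Y)^k] as the sum of the [C(k + j - 1, j) Y^j]; from
    [Y^j = X^(2j) (1 + X)^j] the coefficient of [X^(n - k)] in [Y^j] is
    [C(j, n - k - 2j)], and Vandermonde's identity turns [C(k + j - 1, j)] into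
    the sum over [i] of the [C(k, i) C(j - 1, i - 1)].

    Power series are represented by polynomials over the rationals, and their
    identities by divisibility of a difference by a power of [X]. *)

(** * Runs and admissible words *)

Definition period (b : bool) : nat := if b then 3 else 2.

(** Reading past the end of the word yields [~~ b], so the bound [t <= size w]
    is carried by the letter condition and a word behaves as if it were followed
    by the opposite letter. *)
Lemma is_blockP (w : seq bool) (b : bool) (s t : nat) :
  reflect (s < t /\ forall i, s <= i < t -> nth (~~ b) w i = b) (is_block w b s t).
Proof.
apply: (iffP andP) => [[/andP[st tw]]|[st H]].
  move/(all_nthP (~~ b)) => H; split=> // i ist.
  have := H (i - s); rewrite size_drop size_takel // nth_drop subnKC; last by lia.
  by rewrite nth_take; [move=> Hi; apply/eqP/Hi; lia | lia].
have tw : t <= size w.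
  rewrite leqNgt; apply/negP => wt.
  by have := H t.-1; rewrite nth_default; [case: (b) => Hb; have := Hb ltac:(lia) | lia].
rewrite st tw; split=> //; apply/(all_nthP (~~ b)) => i.
rewrite size_drop size_takel // => ist.
rewrite nth_drop nth_take; last by lia.
by apply/eqP/H; lia.
Qed.

(** Maximality of a block is a local condition: if a longer block contains it,
    then so does one that is longer by a single letter. *)
Lemma is_runP (w : seq bool) (b : bool) (s t : nat) :
  reflect [/\ is_block w b s t, 0 < s -> nth (~~ b) w s.-1 = ~~ b
            & nth (~~ b) w t = ~~ b]
          (is_run w b s t).
Proof.
have neq_b c : c <> b -> c = ~~ b by case: b c => [] [].
have size_le s1 t1 : is_block w b s1 t1 -> t1 < (size w).+1.
  by case/andP=> /andP[].
apply: (iffP andP) => [[Bst M]|[Bst Hs Ht]].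
  have max s' t' : is_block w b s' t' -> s' <= s -> t <= t' -> s' = s /\ t' = t.
    move=> B' les let'; have t'w := size_le _ _ B'.
    have s'w : s' < (size w).+1 by case/is_blockP: B' => ? _; lia.
    move/forallP/(_ (Ordinal s'w))/forallP/(_ (Ordinal t'w)): M => /=.
    by rewrite B' les let' /= => /andP[/eqP-> /eqP->].
  have [st H] := is_blockP _ _ _ _ Bst.
  split=> // [s0|]; apply: neq_b => E.
    suff /max : is_block w b s.-1 t by lia.
    apply/is_blockP; split=> [|i ist]; first by lia.
    by case: (eqVneq i s.-1) => [->//|ne]; apply: H; lia.
  suff /max : is_block w b s t.+1 by lia.
  apply/is_blockP; split=> [|i ist]; first by lia.
  by case: (eqVneq i t) => [->//|ne]; apply: H; lia.
split=> //; apply/forallP=> s'; apply/forallP=> t'; apply/implyP.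
case/and3P=> /is_blockP[st' H'] les let'; have [st H] := is_blockP _ _ _ _ Bst.
apply/andP; split; apply: contraT => ne.
  by move: Hs; rewrite H'; [case: (b) => Hs; have := Hs ltac:(lia) | lia].
by move: Ht; rewrite H'; [case: (b) | lia].
Qed.

Lemma admissibleP (w : seq bool) :
  reflect (forall b s t, is_run w b s t -> period b %| t - s) (admissible w).
Proof.
apply: (iffP forallP) => [H b s t R|H s]; last first.
  by apply/forallP=> t; apply/andP; split; apply/implyP=> /H.
have /andP[/andP[/andP[st tw] _] _] := R.
have sw : s < (size w).+1 by lia.
have tw' : t < (size w).+1 by lia.
move/forallP: (H (Ordinal sw)) => /(_ (Ordinal tw')) /= /andP[].
by case: b R => R; rewrite R.
Qed.

Lemma nth_nseq_cat (T : Type) (x0 b : T) (l : nat) (w : seq T) (i : nat) :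
  nth x0 (nseq l b ++ w) i = if i < l then b else nth x0 w (i - l).
Proof. by rewrite nth_cat size_nseq nth_nseq; case: ltnP. Qed.

(** No run crosses a boundary between distinct letters, so the runs on its two
    sides are independent of each other. *)
Lemma is_run_nseq_cat (b : bool) (l : nat) (w : seq bool) (c : bool) (s t : nat) :
    nth (~~ b) w 0 = ~~ b ->
  is_run (nseq l b ++ w) c s t <->
  [/\ 0 < l, c = b, s = 0 & t = l] \/
  [/\ l <= s, l <= t & is_run w c (s - l) (t - l)].
Proof.
move=> w0; split.
  case/is_runP=> /is_blockP[st H] Hs Ht; case: (ltnP s l) => sl; [left|right].
    have cb : c = b by have := H s; rewrite nth_nseq_cat sl => ->; rewrite ?leqnn.
    subst c.
    have s0 : s = 0.
      apply/eqP; rewrite -leqn0 leqNgt; apply/negP => /[dup] s0 /Hs.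
      by rewrite nth_nseq_cat (_ : s.-1 < l); [case: (b) | lia].
    split=> //; first lia.
    case: (ltngtP t l) => // tl.
      by move: Ht; rewrite nth_nseq_cat tl; case: (b).
    have := H l; rewrite nth_nseq_cat ltnn subnn w0.
    by case: (b) => E; have := E ltac:(lia).
  have lt : l <= t by lia.
  split=> //; apply/is_runP; split.
  - apply/is_blockP; split=> [|i ist]; first by lia.
    have := H (i + l); rewrite nth_nseq_cat (_ : (i + l < l) = false); last by lia.
    by rewrite addnK; apply; lia.
  - move=> sl0; have := Hs; rewrite nth_nseq_cat (_ : (s.-1 < l) = false); last by lia.
    by rewrite (_ : s.-1 - l = (s - l).-1); [apply; lia | lia].
  - by move: Ht; rewrite nth_nseq_cat (_ : (t < l) = false) //; lia.
case=> [[l0 -> -> ->]|[ls lt /is_runP[/is_blockP[st H] Hs Ht]]].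
  apply/is_runP; split=> //; last by rewrite nth_nseq_cat ltnn subnn.
  by apply/is_blockP; split=> // i /andP[_ il]; rewrite nth_nseq_cat il.
apply/is_runP; split.
- apply/is_blockP; split=> [|i ist]; first by lia.
  by rewrite nth_nseq_cat (_ : (i < l) = false); [apply: H; lia | lia].
- move=> s0; rewrite nth_nseq_cat; case: ltnP => sl; last first.
    by rewrite (_ : s.-1 - l = (s - l).-1); [apply: Hs; lia | lia].
  (* The run starts right after the prefix, so its letter differs from b. *)
  have := H 0 ltac:(lia).
  by case: (b) (c) w0 => [] [] //= ->.
- by rewrite nth_nseq_cat (_ : (t < l) = false) //; lia.
Qed.

(** Allowing [l = 0] here lets the two lemmas on leading periods treat words
    that do not start with [b] on the same footing. *)
Lemma admissible_nseq_cat (b : bool) (l : nat) (w : seq bool) :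
    nth (~~ b) w 0 = ~~ b ->
  admissible (nseq l b ++ w) = (period b %| l) && admissible w.
Proof.
move=> w0; apply/admissibleP/andP => [H|[pl /admissibleP H] c s t].
  split.
    case: (posnP l) => [->|l0]; first exact: dvdn0.
    by rewrite -[l]subn0; apply: H; apply/(is_run_nseq_cat _ _ _ _ _ _ w0); left.
  apply/admissibleP=> c s t R; rewrite -(subnDl l); apply: H.
  apply/(is_run_nseq_cat _ _ _ _ _ _ w0); right.
  by rewrite !leq_addr !addKn.
case/(is_run_nseq_cat _ _ _ _ _ _ w0) => [[_ -> -> ->]|[ls lt /H]].
  by rewrite subn0.
by rewrite subnBA // subnK.
Qed.

Lemma split_leading_block (b : bool) (w : seq bool) :
  exists l w', w = nseq l b ++ w' /\ nth (~~ b) w' 0 = ~~ b.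
Proof.
elim: w => [|a w [l [w' [-> w'0]]]]; first by exists 0, [::].
case: (eqVneq a b) => [->|ab]; first by exists l.+1, w'.
by exists 0, (a :: nseq l b ++ w'); split=> //=; case: a b ab {w'0} => [] [].
Qed.

(** The prefix lengthens a possibly empty leading block of [b]s by one period,
    which does not affect divisibility by that period. *)
Lemma admissible_period_cat (b : bool) (w : seq bool) :
  admissible (nseq (period b) b ++ w) = admissible w.
Proof.
have [l [w' [-> w'0]]] := split_leading_block b w.
by rewrite catA -nseqD !admissible_nseq_cat // dvdn_addr.
Qed.

(** The length of the first run is a nonzero multiple of its period. *)
Lemma admissible_leading (b : bool) (w : seq bool) :
    admissible w -> nth (~~ b) w 0 = b ->
  exists w', w = nseq (period b) b ++ w'.
Proof.
have [l [w' [-> w'0]]] := split_leading_block b w.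
rewrite admissible_nseq_cat // => /andP[pl _].
case: (posnP l) => [->|l0 _]; first by rewrite /= w'0; case: (b).
exists (nseq (l - period b) b ++ w').
by rewrite catA -nseqD subnKC // dvdn_leq.
Qed.

(** * Counting admissible words *)

Definition nb_admissible (m : nat) : nat :=
  #|[set w : m.-tuple bool | admissible w]|.

Lemma nb_admissible0 : nb_admissible 0 = 1.
Proof.
rewrite /nb_admissible (_ : [set _ | _] = setT) ?cardsT ?card_tuple //.
apply/setP=> w; rewrite !inE tuple0; apply/admissibleP=> b s t.
by case/is_runP=> /andP[/= /andP[st]]; lia.
Qed.

(** Deleting the leading period is a bijection onto the admissible words that
    are shorter by one period. *)
Lemma card_admissible_leading (b : bool) (m : nat) :
  #|[set w : m.-tuple bool | admissible w && (nth (~~ b) w 0 == b)]| =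
  if m < period b then 0 else nb_admissible (m - period b).
Proof.
case: ltnP => [mp|pm].
  apply/eqP; rewrite cards_eq0 -subset0; apply/subsetP=> w; rewrite inE.
  case/andP=> aw /eqP wb; have [w' E] := admissible_leading _ _ aw wb.
  by have := size_tuple w; rewrite E size_cat size_nseq; lia.
have [q ->] : exists q, m = period b + q by exists (m - period b); rewrite subnKC.
rewrite addKn.
rewrite /nb_admissible -(card_imset _ (f := fun w : q.-tuple bool =>
  [tuple of [tuple of nseq (period b) b] ++ w])); last first.
  move=> u v /(congr1 (drop (period b) \o val)) /=.
  by rewrite !drop_size_cat ?size_nseq // => /val_inj.
apply: eq_card => w; rewrite inE; apply/andP/imsetP => [[aw /eqP wb]|[u]].
  have [w' E] := admissible_leading _ _ aw wb.
  have sw' : size w' == q.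
    by have := size_tuple w; rewrite E size_cat size_nseq => /addnI ->.
  exists (Tuple sw'); last exact: val_inj.
  by rewrite inE -(admissible_period_cat b) -E.
rewrite inE => au ->; rewrite /= admissible_period_cat au; split=> //.
by rewrite nth_nseq_cat; case: (b).
Qed.

(** A nonempty word starts with 0 or with 1; these give the terms for 2 and 3. *)
Lemma nb_admissible_rec (m : nat) :
  nb_admissible m =
  (m == 0) + (if m < 2 then 0 else nb_admissible (m - 2))
           + (if m < 3 then 0 else nb_admissible (m - 3)).
Proof.
case: m => [|m]; first by rewrite nb_admissible0.
rewrite add0n -(card_admissible_leading false) -(card_admissible_leading true).
rewrite {1}/nb_admissible -(cardsID [set w : m.+1.-tuple bool | nth true w 0 == false]).
congr (_ + _); apply: eq_card => w; rewrite !inE ?(andbC (~~ _)) //.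
by congr (_ && _); case/tupleP: w => -[] w.
Qed.

(** * Truncated power series *)

Local Open Scope ring_scope.

Lemma dvdp_XnP (F : fieldType) (p : {poly F}) (n : nat) :
  reflect (forall i, (i < n)%N -> p`_i = 0) ('X^n %| p).
Proof.
apply: (iffP (dvdpP _ _)) => [[q -> i i_n]|p0]; first by rewrite coefMXn i_n.
exists (drop_poly n p); rewrite -[LHS](poly_take_drop n).
suff -> : take_poly n p = 0 by rewrite add0r.
by apply/polyP=> i; rewrite coef_take_poly coef0; case: ifP => // /p0.
Qed.

(** The partial sums for [k + 1], multiplied by [1 - y], telescope by Pascal's
    rule to those for [k]. At [k = 0] the index [(k + j).-1] still gives the
    right coefficients: 1 for [j = 0], and [C(j - 1, j) = 0] afterwards. *)
Lemma negative_binomial_step (R : comNzRingType) (y : R) (k N : nat) :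
  (1 - y) * (\sum_(j < N.+1) 'C(k + j, j)%:R * y ^+ j) =
  \sum_(j < N.+1) 'C((k + j).-1, j)%:R * y ^+ j - 'C(k + N, N)%:R * y ^+ N.+1.
Proof.
elim: N => [|N IH]; first by rewrite !big_ord1 !bin0; ring.
rewrite big_ord_recr mulrDr IH [in RHS]big_ord_recr /= addnS binS natrD /=.
by rewrite !exprS; ring.
Qed.

(** The series of [(1 - y)^-k], in a form that is meaningful in any
    commutative ring. *)
Lemma negative_binomial (R : comNzRingType) (y : R) (k N : nat) :
  exists r, (1 - y) ^+ k * (\sum_(j < N.+1) 'C((k + j).-1, j)%:R * y ^+ j) =
            1 + y ^+ N.+1 * r.
Proof.
elim: k => [|k [r IH]].
  exists 0; rewrite mulr0 addr0 expr0 mul1r big_ord_recl big1 /= => [|j _].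
    by rewrite bin0 mulr1 addr0.
  by rewrite bin_small ?mul0r // add0n.
exists (r - (1 - y) ^+ k * 'C(k + N, N)%:R).
rewrite exprSr -mulrA negative_binomial_step mulrBr IH; ring.
Qed.

(** The generating function, by length, of the two blocks 00 and 111 from which
    admissible words are built. *)
Definition step_poly : {poly rat} := 'X^2 + 'X^3.

Definition admissible_poly (n : nat) : {poly rat} :=
  \poly_(i < n) (nb_admissible i)%:R.

Lemma admissible_poly_inverse (n : nat) :
  'X^n %| admissible_poly n * (1 - step_poly) - 1.
Proof.
apply/dvdp_XnP=> i i_n; rewrite mulrBr mulr1 mulrDr !coefB coefD !coefMXn.
rewrite !coef_poly coef1 i_n !(leq_ltn_trans (leq_subr _ _) i_n).
rewrite nb_admissible_rec !natrD !(fun_if (fun q => q%:R : rat)).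
by rewrite -(addrA (if i == 0%N then _ else _)) addrK subrr.
Qed.

(** This is the expansion of [X^(2j) (1 + X)^j]; the convention that binomial
    coefficients with a negative lower index vanish covers [m < 2j]. *)
Lemma coef_step_polyX (j m : nat) :
  (step_poly ^+ j)`_m = (binz j%:Z (m%:Z - 2%:Z * j%:Z))%:R.
Proof.
have -> : step_poly ^+ j = 'X^(2 * j) * ('X + 1) ^+ j.
  by rewrite exprM -exprMn mulrDr mulr1 -exprSr addrC.
rewrite coefXnM; case: ltnP => [mj|jm].
  have : m%:Z - 2%:Z * j%:Z < 0 by lia.
  by case: (m%:Z - 2%:Z * j%:Z).
rewrite (_ : m%:Z - 2%:Z * j%:Z = (m - 2 * j)%N%:Z); last by lia.
have -> : ('X + 1) ^+ j = \poly_(i < j.+1) ('C(j, i)%:R : rat).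
  by rewrite exprD1n poly_def; apply: eq_bigr => i _; rewrite scaler_nat.
by rewrite coef_poly /=; case: ltnP => // jm'; rewrite bin_small.
Qed.

(** Expanding the [k]-th power of the generating function of [f0] on positive
    integers chooses one part in each factor. *)
Lemma c1_coef (n k : nat) :
  (c1 n k)%:R = (('X * admissible_poly n) ^+ k)`_n.
Proof.
(* As f0 0 = f0 1 is not zero, the factor [0 < i] excludes empty parts. *)
have -> : 'X * admissible_poly n =
    \sum_(i < n.+1) ((0 < i)%N * f0 i)%:R *: 'X^i.
  rewrite big_ord_recl mul0n scale0r add0r /admissible_poly poly_def mulr_sumr.
  by apply: eq_bigr => i _; rewrite -scalerAr -exprS mul1n.
have -> (p : {poly rat}) : p ^+ k = \prod_(a < k) p.
  by rewrite prodr_const card_ord.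
rewrite bigA_distr_bigA coef_sum natr_sum big_mkcond /=; apply: eq_bigr => t _.
rewrite scaler_prod prodrXr coefZ coefXn -natr_prod eq_sym.
case: forallP => /= [t_gt0|t0].
  case: ifP => _; rewrite ?mulr0 // mulr1; congr _%:R.
  by apply: eq_bigr => a _; rewrite t_gt0 mul1n.
have /existsP[a ta] : [exists a, ~~ (0 < t a)%N].
  by rewrite -negb_forall; apply/forallP.
by rewrite (bigD1 a) //= (negbTE ta) !mul0n mul0r.
Qed.

(** * The coefficients *)

Lemma binz_predS (j i : nat) :
  binz (j.+1%:Z - 1) (i.+1%:Z - 1) = 'C(j, i).
Proof. by rewrite -[j.+1]addn1 -[i.+1]addn1 !PoszD !addrK. Qed.

Lemma binz_pred_small (j i : nat) : (j < i)%N ->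
  binz (j%:Z - 1) (i%:Z - 1) = 0%N.
Proof.
case: i => // i ji; case: j ji => [_|j ji]; last by rewrite binz_predS bin_small.
by rewrite -[i.+1]addn1 PoszD addrK.
Qed.

(** Vandermonde's identity, read with [i - 1] and [k - i] as the lower indices. *)
Lemma Vandermonde_binz (k j : nat) : (0 < k)%N ->
  (\sum_(0 <= i < k.+1) 'C(k, i) * binz (j%:Z - 1) (i%:Z - 1))%N = 'C((k + j).-1, j).
Proof.
case: k => // k _; rewrite big_nat_recl //; case: j => [|j].
  by rewrite !bin0 big1_seq // => i _; rewrite binz_pred_small ?muln0.
rewrite (_ : binz (j.+1%:Z - 1) (0%:Z - 1) = 0%N); last first.
  by rewrite -[j.+1]addn1 PoszD addrK.
rewrite muln0 add0n big_mkord -[RHS]bin_sub; last by lia.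
rewrite (_ : (k.+1 + j.+1).-1 = j + k.+1)%N; last by lia.
rewrite (_ : j + k.+1 - j.+1 = k)%N; last by lia.
rewrite -binomial.Vandermonde; apply: eq_bigr => i _.
by rewrite binz_predS mulnC -subSS bin_sub.
Qed.

(** Modulo [X^(m+1)], the series of compositions is the [k]-th power of
    [1 / (1 - step_poly)]: both cancel against [(1 - step_poly)^k]. *)
Lemma coef_admissible_polyX (n k m : nat) : (m < n)%N ->
  (admissible_poly n ^+ k)`_m =
  \sum_(j < m.+1) 'C((k + j).-1, j)%:R * (step_poly ^+ j)`_m.
Proof.
move=> mn; set F := admissible_poly n; set y := step_poly.
have [r Q] := negative_binomial _ y k m.
set S := \sum_(j < _) _ in Q.
have S_m : S`_m = \sum_(j < m.+1) 'C((k + j).-1, j)%:R * (y ^+ j)`_m.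
  by rewrite coef_sum; apply: eq_bigr => j _; rewrite mulr_natl coefMn mulr_natl.
rewrite -S_m; apply/eqP; rewrite -subr_eq0 -coefB; apply/eqP.
move: (ltnSn m); apply: (elimT (dvdp_XnP _ _ _)).
have -> : F ^+ k - S =
    ((F * (1 - y)) ^+ k - 1 ^+ k) * S - F ^+ k * ((1 - y) ^+ k * S - 1).
  by rewrite exprMn expr1n; ring.
apply: dvdp_sub.
  apply: dvdp_mulr; rewrite subrXX; apply: dvdp_mulr.
  exact: dvdp_trans (dvdp_exp2l _ mn) (admissible_poly_inverse n).
rewrite Q addrC addKr; apply/dvdp_mull/dvdp_mulr/dvdp_exp2r.
by rewrite /y /step_poly -[X in X %| _]expr1 dvdp_add // dvdp_exp2l.
Qed.

Local Close Scope ring_scope.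

Theorem proposition14 (n k : nat) (hk : 1 <= k <= n) :
  c1 n k =
  \sum_(0 <= i < k.+1) \sum_(i <= j < (n - k).+1)
    'C(k, i) * binz (j%:Z - 1)%R (i%:Z - 1)%R
      * binz j%:Z (n%:Z - k%:Z - 2%:Z * j%:Z)%R.
Proof.
have /andP[k0 kn] := hk; set m := n - k.
have nkE : (n%:Z - k%:Z = m%:Z)%R by lia.
(* The terms with j < i vanish: either 'C(j - 1, i - 1) = 0, or j = 0 < i. *)
transitivity (\sum_(0 <= i < k.+1) \sum_(0 <= j < m.+1)
    'C(k, i) * binz (j%:Z - 1)%R (i%:Z - 1)%R
      * binz j%:Z (m%:Z - 2%:Z * j%:Z)%R); last first.
  apply: eq_big_nat => i _; rewrite nkE.
  rewrite [RHS](big_nat_widenl _ 0) // [RHS]big_mkcond /=; apply: eq_big_nat => j _.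
  by case: leqP => // ji; rewrite binz_pred_small ?muln0.
rewrite exchange_big_nat /=.
apply/eqP; rewrite -(Num.Theory.eqr_nat rat) c1_coef exprMn coefXnM ltnNge kn /=.
rewrite coef_admissible_polyX; last by rewrite /m; lia.
rewrite natr_sum big_mkord; apply/eqP/eq_bigr => j _.
by rewrite -big_distrl /= Vandermonde_binz // natrM coef_step_polyX.
Qed.
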